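(* Let $n=2m>3$ be an even integer. The $n$-tuples of sides $(a,b,a,b,\ldots,a,b)$ represent different equivalence classes of $n$-polygons with $m$ axes if and only if $a$ and $b$ have the following four properties: (1) $a\in\mathbb{N}$ with $a\equiv 1 \pmod 2$; (2) $b\in\mathbb{N}$ with $b\equiv 1 \pmod 2$; (3) $1\le a<b\le n-1$; (4) $\gcd(u,m)=1$, where $u:=\frac{a+b}{2}$.
   Context: Fix $n\ge 3$ and the vertices $v_k=e^{2\pi i k/n}$, $k=0,1,\ldots,n-1$, on the unit circle. An $n$-polygon is a Hamiltonian cycle through these $n$ vertices: given an $n$-cycle $(\sigma_1,\ldots,\sigma_n)$ of the numbers $0,\ldots,n-1$ in some order, the polygon is the closed path $v_{\sigma_1}v_{\sigma_2}\cdots v_{\sigma_n}v_{\sigma_1}$ made of the straight segments $\overline{v_{\sigma_i}v_{\sigma_{i+1}}}$ (with $\sigma_{n+1}=\sigma_1$). Its $i$-th side (or ''length'') is the integer $e_i\in\{1,\ldots,n-1\}$ with $e_i\equiv\sigma_{i+1}-\sigma_i \pmod n$, i.e. the $i$-th edge goes counterclockwise $e_i$ positions; the polygon is described by the $n$-tuple of sides $(e_1,\ldots,e_n)$ (considered cyclically). Conversely, an $n$-tuple $(e_1,\ldots,e_n)$ with entries in $\{1,\ldots,n-1\}$ represents an $n$-polygon if, starting at a vertex and moving successively counterclockwise by $e_1,e_2,\ldots,e_n$ positions, every vertex is visited exactly once before returning to the start after the $n$-th step. Two $n$-polygons are equivalent if one is obtained from the other by a rotation about the center of the circle. An $n$-polygon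 with $m$ axes is an $n$-polygon having exactly $m$ axes of reflection symmetry. *)

(* Defs.v *)
From mathcomp Require Import all_boot all_order all_fingroup all_algebra.
From mathcomp Require Import all_classical all_reals all_analysis.
From mathcomp Require Import complex.

Set Implicit Arguments.
Unset Strict Implicit.
Unset Printing Implicit Defensive.

Import Order.TTheory GRing.Theory Num.Theory.

Local Open Scope classical_set_scope.
Local Open Scope ring_scope.
Local Open Scope complex_scope.

(* A polygon is given by the sequence s of its vertex indices, in the order    *)
(* in which they are visited: the closed path                                  *)
(*   v_(s 0) v_(s 1) ... v_(s (n-1)) v_(s 0).                                  *)
(* Since s is a permutation, every vertex is visited exactly once; the cyclic  *)
(* successor ordS makes the last side lead back to the start. The choice of    *)
(* the starting vertex is immaterial and is forgotten in [equivalent] below,   *)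
(* whereas the direction of travel matters: the sides of the reversed path are *)
(* the n - e_i and not the e_i.                                                *)
Definition polygon (n : nat) := {perm 'I_n}.

Definition represents n (e : 'I_n -> nat) (s : polygon n) : Prop :=
  forall i : 'I_n,
    (1 <= e i <= n - 1)%N /\ (s (ordS i) = s i + e i %[mod n])%N.

(* The n-tuple (a, b, a, b, ...), numbered from 0. *)
Definition alt_sides n (a b : nat) : 'I_n -> nat :=
  fun i => if odd i then b else a.

Section Plane.
Variable R : realType.

Definition vertex n (k : 'I_n) : R[i] :=
  let t : R := 2 * pi * k%:R / n%:R in cos t +i* sin t.

Definition segment (z w : R[i]) : set R[i] :=
  [set x | exists2 t : R, 0 <= t <= 1 & x = (1 - t)%:C * z + t%:C * w].

Definition figure n (s : polygon n) : set R[i] :=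
  \bigcup_(i : 'I_n) segment (vertex (s i)) (vertex (s (ordS i))).

(* Multiplication by w with `|w| = 1 is the rotation about the center of the  *)
(* circle; k shifts the starting vertex.                                      *)
Definition equivalent n (s s' : polygon n) : Prop :=
  exists w : R[i], `|w| = 1 /\
    exists k : nat, forall i : 'I_n,
      vertex (s' i) = w * vertex (s (iter k (@ordS n) i)).

Definition line (p d : R[i]) : set R[i] :=
  [set x | exists t : R, x = p + t%:C * d].

(* For d != 0, the orthogonal reflection in line p d: it fixes p + t d and    *)
(* sends p + i t d to p - i t d, for t real.                                  *)
Definition reflection (p d x : R[i]) : R[i] := p + d / d^* * (x - p)^*.

(* The axes are counted as lines, i.e. as subsets of the plane. *)
Definition axes n (s : polygon n) : set (set R[i]) :=
  [set L | exists p d : R[i],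
    [/\ d != 0, L = line p d & reflection p d @` figure s = figure s]].

End Plane.

Arguments equivalent R {n} s s'.
Arguments axes R {n} s.

Definition conditions (n m a b : nat) : Prop :=
  [/\ (a = 1 %[mod 2])%N,
      (b = 1 %[mod 2])%N,
      (1 <= a < b)%N /\ (b <= n - 1)%N
    & gcdn ((a + b) %/ 2)%N m = 1%N].

(* Main.v *)
(* A reflection preserving the figure fixes the center and permutes the          *)
(* vertices, the only points of modulus 1 of the figure. So it is                *)
(* x |-> v_c * conj x for a vertex v_c, that is k |-> c - k on the indices, and  *)
(* the axes correspond to the c for which this map preserves the sides.          *)
(* If the sides are a, b, a, b, ... then a and b are odd, and steps a start at   *)
(* vertices of one parity, steps b at those of the other. For odd c the map      *)
(* k |-> c - k swaps the ends of the sides and preserves the polygon; for even c *)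
(* it does so only if a = b. This gives m axes when a <> b and 2m when a = b.    *)
(* Visiting all vertices means that u generates Z/m, as the vertices of even     *)
(* rank differ by multiples of a + b = 2u.                                       *)
Require Import Defs.
From mathcomp Require Import all_boot all_order all_fingroup all_algebra.
From mathcomp Require Import all_classical all_reals all_analysis.
From mathcomp Require Import complex ring lra zify.

Set Implicit Arguments.
Unset Strict Implicit.
Unset Printing Implicit Defensive.

Import Order.TTheory GRing.Theory Num.Theory.

Local Open Scope classical_set_scope.
Local Open Scope ring_scope.
Local Open Scope complex_scope.

(** On the unit circle conjugation is inversion, so symmetries become congruences between vertex
    indices. A reflection preserving the figure fixes the center, hence is x |-> v_c * conj x. A
    chord contained in the figure is a side, so sides go to sides ([chord_side], [flip_figure]), and
    [axesP] identifies the axes with the c < n satisfying [edge_symmetric s c]. For alternating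
    sides these are the odd c if a <> b (m of them) and all c if a = b (n of them), by
    [represents_edge_symmetric] and [edge_symmetric_odd]; so having m axes means a <> b. Partial
    sums of the sides modulo n show that, within the bounds on a and b, oddness and coprimality
    amount to visiting every vertex once ([represents_odd], [represents_coprime],
    [represents_exists]). Finally a rotation cancels in quotients of consecutive vertices, so a
    class is a cyclic tuple of sides ([equivalent_shift], [equivalent_sides]). *)

(** * Roots of unity and the squared modulus *)

Section Cis.
Variable R : realType.
Implicit Types (t : R) (x y z w : R[i]).

Definition cis t : R[i] := cos t +i* sin t.

Lemma cisD s t : cis (s + t) = cis s * cis t.
Proof.
rewrite /cis cosD sinD; apply/eqP; rewrite eq_complex /=.
by rewrite eqxx /= addrC.
Qed.

Lemma cis_conj t : cis t * (cis t)^* = 1.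
Proof.
apply/eqP; rewrite eq_complex /=; apply/andP; split; apply/eqP; last by ring.
by rewrite -[RHS](cos2Dsin2 t); ring.
Qed.

Lemma cis_neq0 t : cis t != 0.
Proof.
by apply/eqP => t0; have := cis_conj t; rewrite t0 mul0r => /esym/eqP; rewrite oner_eq0.
Qed.

Lemma cis_conjV t : (cis t)^* = (cis t)^-1.
Proof. by rewrite -[LHS](mulKf (cis_neq0 t)) cis_conj mulr1. Qed.

(** Half-angle formula: cos t = 1 forces sin (t / 2) = 0, but the sine is positive on ]0, pi[. *)
Lemma cis_eq1 t : 0 <= t < 2 * pi -> cis t = 1 -> t = 0.
Proof.
move=> /andP[t0 t2] [c1 _]; apply/eqP; apply: contraT => tn0.
have tpos : 0 < t by rewrite lt0r tn0.
have tp : 0 < t / 2 < pi by apply/andP; split; lra.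
have := sin_gt0_pi tp; have := cos2Dsin2 (t / 2).
have := cos_mulr2n (t / 2).
rewrite (_ : t / 2 *+ 2 = t) ?c1 => [e1 e2 s0|]; last by lra.
have : sin (t / 2) ^+ 2 = 0 by move: e1 e2; lra.
by move/eqP; rewrite sqrf_eq0 => /eqP; lra.
Qed.

Definition vtx n (k : nat) : R[i] := cis (2 * pi * k%:R / n%:R).

Lemma vertexE n (k : 'I_n) : vertex R k = vtx n k. Proof. by []. Qed.

Lemma vtx0 n : vtx n 0 = 1.
Proof. by rewrite /vtx mulr0 mul0r /cis cos0 sin0. Qed.

Lemma vtxD n j k : vtx n (j + k) = vtx n j * vtx n k.
Proof. by rewrite /vtx natrD mulrDr mulrDl cisD. Qed.

Lemma vtx_neq0 n k : vtx n k != 0. Proof. exact: cis_neq0. Qed.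

Lemma vtx_conj n k : vtx n k * (vtx n k)^* = 1. Proof. exact: cis_conj. Qed.

Lemma vtx_conjV n k : (vtx n k)^* = (vtx n k)^-1. Proof. exact: cis_conjV. Qed.

Lemma vtx_period n : (0 < n)%N -> vtx n n = 1.
Proof.
move=> n0; rewrite /vtx mulfK ?pnatr_eq0 -?lt0n //.
by rewrite [2 * pi]mulr_natl /cis cos2pi sin2pi.
Qed.

Lemma vtx_mod n k : (0 < n)%N -> vtx n (k %% n) = vtx n k.
Proof.
move=> n0; rewrite {2}(divn_eq k n) vtxD.
suff -> : vtx n (k %/ n * n) = 1 by rewrite mul1r.
elim: (k %/ n)%N => [|q IH]; first by rewrite mul0n vtx0.
by rewrite mulSn vtxD IH vtx_period // mulr1.
Qed.

Lemma vtx_inj_lt n j k : (j <= k < n)%N -> vtx n j = vtx n k -> j = k.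
Proof.
move=> /andP[jk kn] e.
have n0 : (0 < n)%N by apply: leq_ltn_trans kn.
have : vtx n (k - j) = 1.
  apply: (mulfI (vtx_neq0 n j)); by rewrite -vtxD subnKC // mulr1.
have pi0 := pi_gt0 R; have nR : 0 < n%:R :> R by rewrite ltr0n.
have kjn : ((k - j)%:R : R) < n%:R.
  by rewrite ltr_nat (leq_ltn_trans (leq_subr _ _) kn).
move/cis_eq1; rewrite ltr_pdivrMr // ltr_pM2l ?mulr_gt0 // kjn andbT.
rewrite divr_ge0 ?(ltW nR) ?mulr_ge0 ?(ltW pi0) //.
move=> /(_ isT)/eqP; rewrite !mulf_eq0 invr_eq0 !pnatr_eq0 (gt_eqF pi0) /=.
rewrite (gtn_eqF n0) orbF subn_eq0 => kj.
by apply/eqP; rewrite eqn_leq jk.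
Qed.

Lemma vtx_eq n j k : (0 < n)%N -> vtx n j = vtx n k <-> (j = k %[mod n])%N.
Proof.
move=> n0; split => [|e]; last by rewrite -(vtx_mod j n0) e vtx_mod.
rewrite -(vtx_mod j n0) -(vtx_mod k n0).
case/orP: (leq_total (j %% n) (k %% n)) => h e; [|symmetry];
  by apply: vtx_inj_lt (esym e) || apply: vtx_inj_lt e; rewrite h ltn_pmod.
Qed.

Lemma vtx_half m : (0 < m)%N -> vtx (2 * m) m = -1.
Proof.
move=> m0; rewrite /vtx (_ : _ / _ = pi); last first.
  rewrite natrM; have : (m%:R : R) != 0 by rewrite pnatr_eq0 -lt0n.
  by move=> h; field.
by rewrite /cis cospi sinpi; apply/eqP; rewrite eq_complex /= oppr0 !eqxx.
Qed.

(** The squared modulus with values in R, within reach of [lra]; the norm of R[i] is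
    complex-valued. *)
Definition sqn z : R := let: a +i* b := z in a ^+ 2 + b ^+ 2.

Lemma sqn_conj z : sqn (conjc z) = sqn z.
Proof. by case: z => a b; rewrite /sqn /= sqrrN. Qed.

Lemma sqnM z w : sqn (z * w) = sqn z * sqn w.
Proof. by case: z w => a b [c d]; rewrite /sqn /=; ring. Qed.

Lemma sqn_cis t : sqn (cis t) = 1.
Proof. by rewrite /sqn /= cos2Dsin2. Qed.

Lemma sqn_eq0 z : sqn z = 0 -> z = 0.
Proof.
case: z => a b; rewrite /sqn /= => /eqP.
by rewrite paddr_eq0 ?sqr_ge0 // !sqrf_eq0 => /andP[/eqP-> /eqP->].
Qed.

Lemma sqn_ge0 z : 0 <= sqn z.
Proof. by case: z => a b; rewrite addr_ge0 ?sqr_ge0. Qed.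

(** Stewart's theorem for the isosceles triangle 0, z, w; it measures how far a chord dips inside
    the circle. *)
Lemma sqn_chord (t : R) z w : sqn z = 1 -> sqn w = 1 ->
  sqn ((1 - t)%:C * z + t%:C * w) = 1 - t * (1 - t) * sqn (z - w).
Proof.
case: z w => a b [c d]; rewrite /sqn /= => h1 h2.
(* For arbitrary z and w the identity acquires correction terms in 1 - |z|^2 and 1 - |w|^2, and is
   then polynomial. *)
suff : 
 ((1 - t) * a - 0 * b + (t * c - 0 * d)) ^+ 2 +
 ((1 - t) * b + 0 * a + (t * d + 0 * c)) ^+ 2 =
 1 - t * (1 - t) * ((a - c) ^+ 2 + (b - d) ^+ 2) - (1-t) * (1 - (a^+2+b^+2)) - t * (1 - (c^+2+d^+2)) by rewrite h1 h2 => ->; ring.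
by ring.
Qed.

End Cis.

(** * Reflections and chords of the unit circle *)

Section Axes.
Variable R : realType.
Implicit Types (t : R) (x y z w p d : R[i]).

Lemma conjcD x y : conjc (x + y) = conjc x + conjc y.
Proof. exact: rmorphD. Qed.

Lemma conjcB x y : conjc (x - y) = conjc x - conjc y.
Proof. exact: rmorphB. Qed.

Lemma conjcM x y : conjc (x * y) = conjc x * conjc y.
Proof. exact: rmorphM. Qed.

Lemma reflectionE p d x : reflection p d x = p + d / conjc d * conjc (x - p).
Proof. by []. Qed.

Lemma sqn_unit_ratio d : d != 0 -> sqn (d / conjc d) = 1.
Proof.
move=> d0; have cd0 : conjc d != 0 by rewrite conjc_eq0.
have sd0 : sqn d != 0 by apply: contra d0 => /eqP/sqn_eq0 ->.
by apply: (mulIf sd0); rewrite mul1r -[in RHS](divfK cd0 d) [RHS]sqnM sqn_conj.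
Qed.

Lemma reflection_isometry p d x y : d != 0 ->
  sqn (reflection p d x - reflection p d y) = sqn (x - y).
Proof.
move=> d0; rewrite !reflectionE.
have -> : p + d / conjc d * conjc (x - p) - (p + d / conjc d * conjc (y - p))
        = d / conjc d * conjc (x - y).
  by rewrite !conjcB; ring.
by rewrite sqnM sqn_unit_ratio // mul1r sqn_conj.
Qed.

(** For |w| = 1, the reflection in the line through 0 directed by a square root of w; [mirror w] is
    its axis. *)
Definition flip w x : R[i] := w * conjc x.

Definition mirror w : set (R[i]) := [set x | flip w x = x].

Lemma flipK w : w * conjc w = 1 -> involutive (flip w).
Proof. by move=> w1 x; rewrite /flip conjcM conjcK mulrA w1 mul1r. Qed.

(** The hypothesis on p puts the line through 0. A fixed point x makes (x - p) / d self-conjugate,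
    hence real. *)
Lemma line_mirror p d w : d != 0 -> w = d / conjc d ->
  p = w * conjc p -> line p d = mirror w.
Proof.
move=> d0 wE pE; have cd0 : conjc d != 0 by rewrite conjc_eq0.
apply/seteqP; split => [x [t ->]|x]; rewrite /mirror /= /flip.
  by rewrite conjcD conjcM conjc_real mulrDr -pE wE; field.
move=> xE; have : conjc ((x - p) / d) = (x - p) / d.
  have xpE : x - p = w * conjc (x - p) by rewrite conjcB mulrBr -pE -[X in X - p]xE.
  by rewrite conjcM conjc_inv [in RHS]xpE wE; field; rewrite cd0 d0.
case E : ((x - p) / d) => [a b] /= [] bE; exists a.
have b0 : b = 0 by lra.
rewrite -[a%:C]/(a +i* 0) -b0 -E; by field.
Qed.

(** The classical equation of a chord; its coefficients are the elementary symmetric functions of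
    the ends. *)
Lemma segment_conj z w x : z * conjc z = 1 -> w * conjc w = 1 ->
  segment z w x -> x + z * w * conjc x = z + w.
Proof.
move=> z1 w1 [t _ ->]; rewrite conjcD !conjcM !conjc_real.
transitivity ((1 - t)%:C * z + t%:C * w + (1 - t)%:C * w * (z * conjc z)
  + t%:C * z * (w * conjc w)); first by ring.
by rewrite z1 w1 rmorphB rmorph1; ring.
Qed.

(* A chord is determined by two of its points: by [segment_conj] they fix the
   sum and the product of its ends. *)
Lemma two_points_chord z w z' w' x y :
  z * conjc z = 1 -> w * conjc w = 1 -> z' * conjc z' = 1 -> w' * conjc w' = 1 ->
  x != y -> segment z w x -> segment z w y ->
  segment z' w' x -> segment z' w' y ->
  (z = z' /\ w = w') \/ (z = w' /\ w = z').
Proof.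
move=> z1 w1 z1' w1' xy.
move=> /(segment_conj z1 w1) e1 /(segment_conj z1 w1) e2.
move=> /(segment_conj z1' w1') e3 /(segment_conj z1' w1') e4.
have cxy : conjc x - conjc y != 0 by rewrite -conjcB conjc_eq0 subr_eq0.
have pE : z * w = z' * w'.
  apply: (mulIf cxy); apply/eqP; rewrite -subr_eq0; apply/eqP.
  transitivity ((x + z * w * conjc x) - (y + z * w * conjc y)
    - ((x + z' * w' * conjc x) - (y + z' * w' * conjc y))); first by ring.
  by rewrite e1 e2 e3 e4; ring.
have sE : z + w = z' + w' by rewrite -e1 -e3 pE.
have wE : w = z' + w' - z by rewrite -sE; ring.
have : (z - z') * (z - w') = 0.
  transitivity (z * z - z * (z' + w') + z' * w'); first by ring.
  by rewrite -sE -pE; ring.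
move/eqP; rewrite mulf_eq0 !subr_eq0 => /orP[] /eqP zE; [left|right];
  by split=> //; rewrite wE zE; ring.
Qed.

(** By [sqn_chord], modulus 1 requires t = 0, t = 1 or z = w. This recovers the vertices from the
    figure. *)
Lemma segment_sqn z w x : sqn z = 1 -> sqn w = 1 -> segment z w x ->
  sqn x <= 1 /\ (sqn x = 1 -> x = z \/ x = w).
Proof.
move=> z1 w1 [t /andP[t0 t1] ->]; rewrite sqn_chord //; split.
  by rewrite lerBlDr lerDl !mulr_ge0 ?sqn_ge0 ?subr_ge0.
move=> e; have : t * (1 - t) * sqn (z - w) = 0 by move: e; lra.
move/eqP; rewrite !mulf_eq0 subr_eq0 -orbA => /or3P[] /eqP.
- by move=> ->; left; rewrite subr0 rmorph1 rmorph0; ring.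
- by move=> <-; right; rewrite subrr rmorph1 rmorph0; ring.
- move/sqn_eq0/eqP; rewrite subr_eq0 => /eqP ->; left.
  by rewrite -mulrDl -rmorphD subrK rmorph1 mul1r.
Qed.

Lemma flip_segment u z w x : segment z w x -> segment (flip u z) (flip u w) (flip u x).
Proof.
move=> [t t01 ->]; exists t => //.
by rewrite /flip conjcD !conjcM !conjc_real; ring.
Qed.

(** * Vertices and sides recovered from the figure *)

Section Figure.
Variables (n : nat) (s : polygon n).
Implicit Types (i j : 'I_n).

Let V i : R[i] := vertex R (s i).

Lemma vertex_unit (i : 'I_n) : vertex R i * conjc (vertex R i) = 1.
Proof. exact: cis_conj. Qed.

Lemma vertex_inj : injective (@vertex R n).
Proof.
move=> i j /vtx_eq; have n0 : (0 < n)%N by apply: leq_ltn_trans (ltn_ord i).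
by move=> /(_ n0); rewrite !modn_small // => /val_inj.
Qed.

Lemma figure_vertex (k : 'I_n) : figure s (vertex R k).
Proof.
exists ((s^-1)%g k) => //; exists 0; first by rewrite lexx ler01.
by rewrite permKV subr0 rmorph1 rmorph0; ring.
Qed.

Lemma figure_sqn x : figure s x ->
  sqn x <= 1 /\ (sqn x = 1 -> exists k : 'I_n, x = vertex R k).
Proof.
move=> [i _ /segment_sqn []]; try exact: sqn_cis.
move=> x1 x1P; split=> // /x1P [] ->; by eexists.
Qed.

(* Of n + 1 points of the chord two lie on the same side of the polygon. *)
Lemma chord_side (a b : 'I_n) : a != b ->
  segment (vertex R a) (vertex R b) `<=` figure s ->
  exists j, (s j = a /\ s (ordS j) = b) \/ (s j = b /\ s (ordS j) = a).
Proof.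
move=> ab sub; have n0 : (0 < n)%N by apply: leq_ltn_trans (ltn_ord a).
pose T (k : 'I_n.+1) : R := k%:R / n%:R.
pose P k := (1 - T k)%:C * vertex R a + (T k)%:C * vertex R b.
have nR : 0 < n%:R :> R by rewrite ltr0n.
have segP k : segment (vertex R a) (vertex R b) (P k).
  exists (T k) => //; rewrite divr_ge0 //= ler_pdivrMr // mul1r ler_nat.
  by rewrite -ltnS.
have /choice[f fP] : forall k, exists j, segment (V j) (V (ordS j)) (P k).
  move=> k; have [j _ jP] := sub _ (segP k); by exists j.
have : ~~ injectiveb f.
  by apply/negP => /injectiveP/leq_card; rewrite !card_ord ltnn.
move=> /injectivePn[k [l kl fkl]]; exists (f k).
have PP : P k != P l.
  apply: contra kl => /eqP e; apply/eqP/val_inj.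
  have vab : vertex R b - vertex R a != 0.
    by rewrite subr_eq0; apply: contra ab => /eqP/vertex_inj ->.
  have /complexI : (T k)%:C = (T l)%:C.
    apply: (mulIf vab); move: e; rewrite /P !rmorphB !rmorph1 => e.
    transitivity (((1 - (T k)%:C) * vertex R a + (T k)%:C * vertex R b) - vertex R a).
      by ring.
    by rewrite e; ring.
  move/(mulIf (invr_neq0 (lt0r_neq0 nR)))/eqP; by rewrite eqr_nat => /eqP.
have Pl := fP l; rewrite -fkl in Pl.
case: (two_points_chord _ _ _ _ PP (segP k) (segP l) (fP k) Pl);
  try exact: vertex_unit; move=> [] /vertex_inj -> /vertex_inj ->; tauto.
Qed.

End Figure.
End Axes.

(** Combinatorial symmetry under k |-> c - k: side i goes to side j, with either orientation. Sums
    avoid truncated subtraction. *)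
Definition edge_symmetric n (s : polygon n) (c : nat) : Prop :=
  forall i, exists j,
    (s j + s i = c %[mod n] /\ s (ordS j) + s (ordS i) = c %[mod n])%N \/
    (s j + s (ordS i) = c %[mod n] /\ s (ordS j) + s i = c %[mod n])%N.

(** * Counting axes through congruences of indices *)

Section CountAxes.
Variable R : realType.

Lemma segmentC (z w : R[i]) : segment z w `<=` segment w z.
Proof.
move=> _ [t /andP[t0 t1] ->]; exists (1 - t).
  by rewrite subr_ge0 t1 gerBl.
by rewrite subKr addrC.
Qed.

Lemma flip_vtx n (c j k : nat) : (0 < n)%N ->
  flip (vtx R n c) (vtx R n j) = vtx R n k <-> (k + j = c %[mod n])%N.
Proof.
move=> n0; rewrite -(vtx_eq R) // vtxD /flip vtx_conjV.
have j0 := vtx_neq0 R n j.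
split=> [<-|<-]; first by rewrite divfK.
by rewrite mulfK.
Qed.

Lemma exists_flip_vertex n (s : polygon n) (c : nat) (i : 'I_n) :
  exists j, (s j + i = c %[mod n])%N.
Proof.
have n0 : (0 < n)%N by apply: leq_ltn_trans (ltn_ord i).
exists ((s^-1)%g (Ordinal (ltn_pmod (c + (n - i)) n0))).
by rewrite permKV /= modnDml -addnA subnK ?modnDr // ltnW.
Qed.

(** The image of a side is a chord between vertices lying in the figure, hence a side by
    [chord_side]. Conversely, an involution mapping the figure into itself maps it onto itself. *)
Lemma flip_figure n (s : polygon n) (c : nat) : (1 < n)%N ->
  flip (vtx R n c) @` figure s = figure s <-> edge_symmetric s c.
Proof.
move=> n1; have n0 : (0 < n)%N by apply: ltnW.
have fK := flipK (vtx_conj R n c).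
split=> [sym i|sym].
  have [j1 e1] := exists_flip_vertex s c (s i).
  have [j2 e2] := exists_flip_vertex s c (s (ordS i)).
  have /(flip_vtx _ _ _ n0) f1 := e1; have /(flip_vtx _ _ _ n0) f2 := e2.
  have sj12 : s j1 != s j2.
    apply/eqP => sj; move: e1; rewrite sj -e2 => /eqP; rewrite eqn_modDl.
    rewrite !modn_small // => /eqP/val_inj/perm_inj/(congr1 val) /=.
    case: (ltngtP i.+1 n) (ltn_ord i) => // [lt|eq] _.
      by rewrite modn_small // => /eqP; rewrite ltn_eqF.
    by rewrite eq modnn => i0; move: eq n1; rewrite i0 => <-.
  case: (@chord_side R n s _ _ sj12) => [x xs|j [] [sj sj']]; last 2 first.
  - by exists j; left; rewrite sj sj'.
  - by exists j; right; rewrite sj sj'.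
  rewrite -sym; exists (flip (vtx R n c) x); last exact: fK.
  exists i => //; rewrite !vertexE -[X in segment X _ _]fK f1.
  by rewrite -[X in segment _ X _]fK f2; apply: flip_segment.
have sub : flip (vtx R n c) @` figure s `<=` figure s.
  move=> _ [x [i _ xs] <-]; have [j jP] := sym i; exists j => //.
  have := flip_segment (vtx R n c) xs; rewrite !vertexE.
  case: jP => -[] /(flip_vtx _ _ _ n0) -> /(flip_vtx _ _ _ n0) -> //.
  exact: segmentC.
apply/seteqP; split=> // x xF; exists (flip (vtx R n c) x); last exact: fK.
by apply: sub; exists x.
Qed.

Lemma vtx_sqrt n c : exists2 d : R[i], d * conjc d = 1 & vtx R n c = d * d.
Proof.
exists (cis (pi * c%:R / n%:R)); first exact: cis_conj.
by rewrite -cisD /vtx; congr cis; rewrite -!mulrA; ring.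
Qed.

(** The mirror of w contains a square root d of w; lying on the mirror of w' as well, d gives w' =
    d^2 = w. *)
Lemma mirror_inj n : injective (fun k : 'I_n => mirror (vtx R n k)).
Proof.
move=> c c' e; apply: (@vertex_inj R); rewrite !vertexE.
have [d d1 cE] := vtx_sqrt n c.
have : mirror (vtx R n c') d by rewrite -e /mirror /= /flip cE -mulrA d1 mulr1.
rewrite /mirror /= /flip => dE.
by rewrite cE -[X in X * _]dE -mulrA (mulrC _ d) d1 mulr1.
Qed.

(* The unit disc is the smallest disc around the figure: two opposite vertices
   are at distance at most 1 from the image of 0 under the reflection. *)
Lemma reflection_fixes_center n m (s : polygon n) p d :
  n = (2 * m)%N -> (0 < m)%N -> d != 0 ->
  reflection p d @` figure s = figure (R := R) s -> reflection p d 0 = 0.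
Proof.
move=> nE m0 d0 sym; set c := reflection p d 0.
have near x : figure s x -> sqn (x - c) <= 1.
  rewrite -sym => -[y /figure_sqn[y1 _] <-].
  by rewrite /c reflection_isometry // subr0.
have n0 : (0 < n)%N by rewrite nE; lia.
have mn : (m < n)%N by rewrite nE; lia.
have := near _ (figure_vertex R s (Ordinal mn)).
have := near _ (figure_vertex R s (Ordinal n0)).
rewrite !vertexE /= vtx0 nE vtx_half //.
case: c {near} => x y; rewrite /sqn /= => h1 h2.
have hh : x ^+ 2 + y ^+ 2 <= 0 by move: h1 h2; lra.
have x0 : x ^+ 2 = 0 by have := sqr_ge0 x; have := sqr_ge0 y; lra.
have y0 : y ^+ 2 = 0 by have := sqr_ge0 x; have := sqr_ge0 y; lra.
move/eqP: x0; move/eqP: y0; rewrite !sqrf_eq0 => /eqP -> /eqP ->; by [].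
Qed.

(** Once 0 is fixed the reflection is [flip w], and w, the image of the vertex 1, is a point of the
    figure of modulus 1, so a vertex. *)
Lemma axesP n m (s : polygon n) : n = (2 * m)%N -> (0 < m)%N ->
  axes R s = (fun c => mirror (vtx R n c)) @` [set c | (c < n)%N /\ edge_symmetric s c].
Proof.
move=> nE m0; have n1 : (1 < n)%N by rewrite nE; lia.
have n0 : (0 < n)%N by apply: ltnW.
apply/seteqP; split => [L [p [d [d0 -> sym]]]|_ [c [cn /(flip_figure _ _ n1) sym] <-]].
  have c0 := reflection_fixes_center nE m0 d0 sym.
  set w := d / conjc d.
  have pE : p = w * conjc p.
    move: c0; rewrite reflectionE -/w conjcB conjc0 sub0r mulrN => /eqP.
    by rewrite subr_eq0 => /eqP.
  have rE : reflection p d = flip w.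
    by apply/funext => x; rewrite reflectionE conjcB mulrBr -/w -pE addrC subrK.
  have [c wE] : exists k : 'I_n, w = vertex R k.
    suff : figure s w by move=> /figure_sqn[_]; apply; apply: sqn_unit_ratio.
    rewrite -sym rE; exists (vertex R (Ordinal n0)); first exact: figure_vertex.
    by rewrite vertexE /= vtx0 /flip conjc1 mulr1.
  exists (val c); last by rewrite -vertexE -wE -(line_mirror d0 _ pE).
  split; first exact: ltn_ord.
  by apply/(flip_figure s c n1); rewrite -vertexE -wE -rE.
have [d d1 cE] := vtx_sqrt n c.
have d0 : d != 0.
  by apply/eqP => d0; move: d1; rewrite d0 mul0r => /esym/eqP; rewrite oner_eq0.
have cd0 : conjc d != 0 by rewrite conjc_eq0.
have cE' : vtx R n c = d / conjc d.
  by rewrite cE; apply: (mulIf cd0); rewrite divfK // -mulrA d1 mulr1.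
exists 0, d; split=> //.
  by rewrite (line_mirror d0 cE') // conjc0 mulr0.
rewrite -[RHS]sym; congr (_ @` _); apply/funext => x.
by rewrite reflectionE add0r subr0 -cE'.
Qed.

(** Here [f] enumerates the admissible c; it is used with the identity (a = b) and with k |-> 2k + 1
    (a <> b). *)
Lemma card_axes n m (s : polygon n) (f : nat -> nat) k :
  n = (2 * m)%N -> (0 < m)%N -> injective f ->
  (forall c, ((c < n)%N /\ edge_symmetric s c) <-> exists2 i, (i < k)%N & c = f i) ->
  (axes R s #= `I_k)%card.
Proof.
move=> nE m0 finj fP; rewrite (axesP s nE m0).
have -> : [set c | (c < n)%N /\ edge_symmetric s c] = f @` `I_k.
  by apply/seteqP; split=> c /=; rewrite fP => -[i ik]; exists i.
rewrite image_comp; apply: inj_card_eq => i j /set_mem /= ik /set_mem /= jk.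
have ltf x : (x < k)%N -> (f x < n)%N.
  by move=> xk; have [] := (fP (f x)).2 (ex_intro2 _ _ x xk erefl).
have := @mirror_inj n (Ordinal (ltf _ ik)) (Ordinal (ltf _ jk)).
by move=> /[apply] /(congr1 val) /= /finj.
Qed.

End CountAxes.

Lemma dvdn_double n x : (0 < x < n)%N -> (n %| 2 * x)%N -> (2 * x)%N = n.
Proof.
move=> /andP[x0 xn] /dvdnP[q qE]; rewrite qE; case: q qE => [|[|q]]; [lia|lia|].
by rewrite !mulSn => qE; have := leq_addr (q * n) (n + n); lia.
Qed.

Lemma ordS_ind n (i0 : 'I_n) (P : 'I_n -> Prop) : i0 = 0%N :> nat ->
  P i0 -> (forall i, P i -> P (ordS i)) -> forall i, P i.
Proof.
move=> i00 P0 PS [k kn]; elim: k kn => [|k IH] kn.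
  by rewrite (_ : Ordinal kn = i0) //; apply: val_inj.
rewrite (_ : Ordinal kn = ordS (Ordinal (ltnW kn))); first exact/PS/IH.
by apply: val_inj; rewrite /= modn_small.
Qed.

(** * Polygons with alternating sides *)

Section AlternatingSides.
Variables n m : nat.
Hypotheses (nE : n = (2 * m)%N) (n3 : (3 < n)%N).

Let m0 : (0 < m)%N. Proof. lia. Qed.
Let n0 : (0 < n)%N. Proof. lia. Qed.
Let i0 : 'I_n := Ordinal n0.
Let nodd : odd n = false. Proof. by rewrite nE oddM. Qed.

Lemma odd_eqmod x y : (x = y %[mod n])%N -> odd x = odd y.
Proof. by move=> e; rewrite -(odd_mod x nodd) e odd_mod. Qed.

Lemma odd_ordS (i : 'I_n) : odd (ordS i) = ~~ odd i.
Proof. by rewrite /= odd_mod. Qed.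

Lemma alt_sides_ordS a b (i : 'I_n) : alt_sides a b (ordS i) = alt_sides b a i.
Proof. by rewrite /alt_sides odd_ordS; case: odd. Qed.

(** Closed form of the displacement after k steps. *)
Definition psum a b k := (k./2 * (a + b) + odd k * a)%N.

Lemma psumS a b k : psum a b k.+1 = (psum a b k + if odd k then b else a)%N.
Proof.
by rewrite /psum -uphalfE uphalf_half /=; case: (odd k); rewrite /=; lia.
Qed.

Lemma psum_full a b : psum a b n = (m * (a + b))%N.
Proof. by rewrite /psum nodd nE mul2n doubleK addn0. Qed.

Lemma odd_psum a b k : odd a -> odd (a + b) = false -> odd (psum a b k) = odd k.
Proof. by move=> ao ev; rewrite /psum oddD !oddM ev ao andbF andbT oddb. Qed.

Section Represents.
Variables (a b : nat) (s : polygon n).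
Hypothesis sab : represents (alt_sides a b) s.

Lemma represents_bounds : (1 <= a <= n - 1)%N /\ (1 <= b <= n - 1)%N.
Proof.
by split; [have [+ _] := sab i0|have [+ _] := sab (ordS i0)];
  rewrite ?alt_sides_ordS.
Qed.

Lemma represents_psum (i : 'I_n) : (s i = s i0 + psum a b i %[mod n])%N.
Proof.
case: i => k kn /=; elim: k kn => [|k IH] kn.
  by rewrite /psum /= addn0; congr (nat_of_ord (s _) %% _)%N; apply: val_inj.
have -> : Ordinal kn = ordS (Ordinal (ltnW kn)).
  by apply: val_inj; rewrite /= modn_small.
have [_ ->] := sab (Ordinal (ltnW kn)).
by rewrite -modnDml IH modnDml psumS addnA.
Qed.

(** The step from index n - 1 leads back to the start, so the total displacement is 0 modulo n. *)
Lemma represents_closed : (n %| m * (a + b))%N.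
Proof.
have n1n : (n.-1 < n)%N by lia.
have [_] := sab (Ordinal n1n).
have -> : ordS (Ordinal n1n) = i0 by apply: val_inj; rewrite /= prednK // modnn.
rewrite -[in RHS]modnDml (represents_psum (Ordinal n1n)) modnDml -addnA -psumS /= prednK //.
rewrite psum_full -[in LHS](addn0 (s i0)) => /eqP.
by rewrite eqn_modDl mod0n eq_sym.
Qed.

Lemma represents_even_sum : odd (a + b) = false.
Proof.
have := represents_closed; rewrite nE mulnC dvdn_pmul2l // dvdn2.
exact: negbTE.
Qed.

(** If a were even, so would be b, and all visited vertices would share one parity; but 0 and 1 are
    both visited. *)
Lemma represents_odd : odd a /\ odd b.
Proof.
have ev := represents_even_sum; suff ao : odd a.
  by split=> //; move: ev; rewrite oddD ao; case: (odd b).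
apply: contraT => /negbTE ae.
have par i : odd (s i) = odd (s i0).
  rewrite (odd_eqmod (represents_psum i)) /psum oddD oddD !oddM ev ae.
  by rewrite !andbF !addbF.
have n1 : (1 < n)%N by lia.
by have := par ((s^-1)%g (Ordinal n1)); have := par ((s^-1)%g i0); rewrite !permKV /= => <-.
Qed.

(** With g = gcd(u, m), the displacement after 2m/g steps is (u/g) n, so g > 1 would mean a
    premature return. *)
Lemma represents_coprime : gcdn ((a + b) %/ 2) m = 1%N.
Proof.
have ev := represents_even_sum.
have e2 : (a + b = 2 * ((a + b) %/ 2))%N by rewrite mulnC divnK // dvdn2 ev.
set u := ((a + b) %/ 2)%N in e2 *; set g := gcdn u m.
have g0 : (0 < g)%N by rewrite gcdn_gt0 m0 orbT.
have [u' uE] := dvdnP (dvdn_gcdl u m : (g %| u)%N).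
have [m' mE] := dvdnP (dvdn_gcdr u m : (g %| m)%N).
apply/eqP; apply: contraT => g1.
have m'0 : (0 < m')%N by move: m0; rewrite mE; case: (m').
have lt : (2 * m' < n)%N.
  rewrite nE ltn_pmul2l // [X in (_ < X)%N]mE ltn_Pmulr //; lia.
have := represents_psum (Ordinal lt).
have -> : (psum a b (Ordinal lt) = u' * n)%N.
  rewrite /psum /= oddM /= mul2n doubleK e2 uE nE [in RHS]mE; lia.
rewrite addnC modnMDl !modn_small // => /val_inj/perm_inj/(congr1 val) /=; lia.
Qed.

Lemma represents_parity i : odd (s i) = odd (s i0) (+) odd i.
Proof.
have [ao _] := represents_odd.
by rewrite (odd_eqmod (represents_psum i)) oddD odd_psum // represents_even_sum.
Qed.

(** Pair side i with the side j starting at c - s(i+1). For odd c, j and i+1 have opposite parity,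
    so sides i and j are equally long, which settles the other ends. *)
Lemma represents_edge_symmetric c : a = b \/ odd c -> edge_symmetric s c.
Proof.
move=> abc i; have [j e] := exists_flip_vertex s c (s (ordS i)).
exists j; right; split=> //.
have [_ sj] := sab j; have [_ si] := sab i.
suff ej : alt_sides a b j = alt_sides a b i.
  by rewrite -modnDml sj modnDml ej addnAC -addnA -modnDmr -si modnDmr.
case: abc => [->|co]; first by rewrite /alt_sides !if_same.
have := odd_eqmod e; rewrite oddD (represents_parity j) (represents_parity (ordS i)) odd_ordS co /alt_sides.
by case: (odd j); case: (odd i); case: (odd _).
Qed.

(** Let c be even. If side i goes to side j with ends in order, both have the same length e and 2e =
    0 modulo n, so 2e = n. If the ends are swapped, i and j differ in parity and a = b. Hence every
    side is a diameter, and again a = b. *)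
Lemma edge_symmetric_odd c : a <> b -> edge_symmetric s c -> odd c.
Proof.
move=> ab sym; apply: contraT => ce.
have [/andP[a1 an] /andP[b1 bn]] := represents_bounds.
have alt_lt (i : 'I_n) : (0 < alt_sides a b i < n)%N.
  by rewrite /alt_sides; case: ifP => _; lia.
have half (i : 'I_n) : (2 * alt_sides a b i)%N = n.
  have [j [[e1 e2]|[e1 e2]]] := sym i; have [_ sj] := sab j; have [_ si] := sab i.
    have := odd_eqmod e1; rewrite oddD (represents_parity j) (represents_parity i) (negbTE ce) => par.
    have ej : alt_sides a b j = alt_sides a b i.
      by rewrite /alt_sides; move: par; case: (odd j); case: (odd i); case: (odd _).
    have : (s j + s i + 2 * alt_sides a b i = s j + s i + 0 %[mod n])%N.
      rewrite addn0 e1 -e2 -[in RHS]modnDml sj modnDml ej -[in RHS]modnDmr si modnDmr.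
      by congr (_ %% _)%N; lia.
    by move/eqP; rewrite eqn_modDl mod0n; apply: dvdn_double.
  have := odd_eqmod e1; rewrite oddD (represents_parity j).
  rewrite (represents_parity (ordS i)) odd_ordS (negbTE ce) => par.
  have : (s j + s i + alt_sides a b j = s j + s i + alt_sides a b i %[mod n])%N.
    transitivity (c %% n)%N.
      by rewrite -e2 -[in RHS]modnDml sj modnDml; congr (_ %% _)%N; lia.
    by rewrite -e1 -[in LHS]modnDmr si modnDmr; congr (_ %% _)%N; lia.
  move/eqP; rewrite eqn_modDl => /eqP; have := alt_lt j; have := alt_lt i.
  move=> /andP[_ li] /andP[_ lj]; rewrite !modn_small // /alt_sides.
  by move: par; case: (odd j); case: (odd i); case: (odd _) => //= _ eab; case: ab.
have := half i0; have := half (ordS i0); rewrite alt_sides_ordS /alt_sides /=; lia.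
Qed.

End Represents.

(** Take partial sums from vertex 0. Equal values force indices of equal parity, and then m divides
    u (j/2 - i/2), halves rounded down; as u is prime to m and the difference is below m, it
    vanishes. *)
Lemma represents_exists a b : odd a -> odd b ->
  (1 <= a <= n - 1)%N -> (1 <= b <= n - 1)%N -> gcdn ((a + b) %/ 2) m = 1%N ->
  exists s : polygon n, represents (alt_sides a b) s.
Proof.
move=> ao bo an bn cop; have ev : odd (a + b) = false by rewrite oddD ao bo.
have e2 : (a + b = 2 * ((a + b) %/ 2))%N by rewrite mulnC divnK // dvdn2 ev.
pose f (i : 'I_n) : 'I_n := Ordinal (ltn_pmod (psum a b i) n0).
have finj : injective f.
  suff inj (i j : 'I_n) : (i <= j)%N -> f i = f j -> i = j.
    by move=> i j e; case/orP: (leq_total i j) => /inj; [apply|move/(_ (esym e))].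
  move=> ij /(congr1 val) /= e.
  have := odd_eqmod e; rewrite !odd_psum // => par.
  move: e; rewrite /psum par => /eqP; rewrite eqn_modDr.
  rewrite eq_sym eqn_mod_dvd ?leq_mul ?half_leq // -mulnBl => dv.
  have d : (m %| j./2 - i./2)%N.
    have : (2 * m %| 2 * ((a + b) %/ 2 * (j./2 - i./2)))%N.
      by rewrite -nE mulnA -e2 mulnC.
    by rewrite dvdn_pmul2l // Gauss_dvdr // coprime_sym; apply/eqP.
  apply: val_inj; rewrite /= -(odd_double_half i) -(odd_double_half j) par.
  have dm : (j./2 - i./2 < m)%N by have := ltn_ord j; lia.
  have : (j./2 - i./2 = 0)%N by apply/eqP; rewrite -leqn0 leqNgt; apply: contraL d => h; rewrite gtnNdvd.
  have := half_leq ij; lia.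
exists (perm finj) => i; split; first by rewrite /alt_sides; case: ifP.
rewrite !permE /= modn_mod modnDml /alt_sides -psumS.
(* At the last index the walk closes up because the total is m (a + b) = u n. *)
case: (ltngtP i.+1 n) (ltn_ord i) => // [lt|->] _; first by rewrite (modn_small lt).
by rewrite modnn psum_full e2 mulnCA mulnA -nE modnMr mod0n.
Qed.

End AlternatingSides.

(** * Rotation classes and cyclic shifts of the sides *)

Section Equivalence.
Variables (R : realType) (n m : nat).
Hypotheses (nE : n = (2 * m)%N) (n3 : (3 < n)%N).

Let n0 : (0 < n)%N. Proof. lia. Qed.
Let i0 : 'I_n := Ordinal n0.

Lemma represents_vertex (e : 'I_n -> nat) (s : polygon n) i : represents e s ->
  vertex R (s (ordS i)) = vertex R (s i) * vtx R n (e i).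
Proof. by move=> se; rewrite !vertexE -vtxD; apply/vtx_eq => //; have [] := se i. Qed.

Lemma norm_vtx k : `|vtx R n k| = 1.
Proof.
by apply/eqP; rewrite -sqrp_eq1 // sqr_normc vtx_conj.
Qed.

Lemma equivalent_shift (e e' : 'I_n -> nat) (s s' : polygon n) k :
  represents e s -> represents e' s' ->
  (forall i, e' i = e (iter k (@ordS n) i)) -> equivalent R s s'.
Proof.
move=> se se' ee; set j0 := s (iter k (@ordS n) i0).
(* The rotation carrying the shifted start [j0] of s to the start of s'; n - j0 stands for -j0. *)
exists (vtx R n (s' i0 + (n - j0))); split; first exact: norm_vtx.
exists k; apply: (@ordS_ind _ i0) => // [|i IH].
  rewrite -/j0 !vertexE -vtxD -addnA subnK ?vtxD; last exact/ltnW/ltn_ord.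
  rewrite vtx_period // mulr1; congr (vtx R n (s' _)); exact: val_inj.
rewrite -iterSr iterS (represents_vertex _ se') (represents_vertex _ se).
by rewrite mulrA -IH ee.
Qed.

(** Quotients of consecutive vertices eliminate w, and sides below n are determined by their
    residues. *)
Lemma equivalent_sides (e e' : 'I_n -> nat) (s s' : polygon n) :
  represents e s -> represents e' s' -> equivalent R s s' ->
  exists k, forall i, e' i = e (iter k (@ordS n) i).
Proof.
move=> se se' [w [_ [k wP]]]; exists k => i.
have := wP (ordS i).
rewrite -iterSr iterS (represents_vertex _ se') (represents_vertex _ se).
rewrite mulrA -wP => /(mulfI (vtx_neq0 R n _))/vtx_eq => /(_ n0).
have [/andP[_ h] _] := se' i; have [/andP[_ h'] _] := se (iter k (@ordS n) i).
by rewrite !modn_small //; lia.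
Qed.

Lemma equivalent_alt_sides a b a' b' (s s' : polygon n) :
  represents (alt_sides a b) s -> represents (alt_sides a' b') s' ->
  equivalent R s s' -> (a' = a /\ b' = b) \/ (a' = b /\ b' = a).
Proof.
move=> sab sab' /(equivalent_sides sab sab')[k kP].
have := kP i0; have := kP (ordS i0).
rewrite -iterSr iterS !(alt_sides_ordS nE) /alt_sides /= => -> ->.
by case: odd; [right|left].
Qed.

End Equivalence.

(** The form symmetric in a and b, matching what a polygon yields without knowing which side is
    shorter. *)
Lemma conditionsP n m a b :
  (conditions n m a b \/ conditions n m b a) <->
  [/\ odd a /\ odd b, (1 <= a <= n - 1)%N /\ (1 <= b <= n - 1)%N,
      gcdn ((a + b) %/ 2) m = 1%N & a <> b].
Proof.
split.
  case=> -[]; rewrite !modn2 => o1 o2 [/andP[h1 h2] h3] g;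
    split; try (by [lia|rewrite addnC]);
    by move: o1 o2; case: odd; case: odd.
move=> [[ao bo] [/andP[a1 an] /andP[b1 bn]] g ab].
case: (ltngtP a b) => // lt; [left|right]; split; rewrite ?modn2 ?ao ?bo //.
- by split=> //; apply/andP.
- by split=> //; apply/andP.
- by rewrite addnC.
Qed.

(** * The characterization and the classes *)

Local Open Scope card_scope.

Theorem mainTheorem1 (R : realType) (n m : nat) (hn : n = (2 * m)%N)
    (hn3 : (3 < n)%N) :
  (* which tuples (a,b,...,a,b) represent n-polygons with exactly m axes;
     (a,b,...) and (b,a,...) are the same cyclic tuple *)
  (forall a b : nat,
     (exists s : polygon n,
        represents (alt_sides a b) s /\ axes R s #= `I_m) <->
     (conditions n m a b \/ conditions n m b a)) /\
  (* different pairs satisfying the conditions give different classes *)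
  (forall (a b a' b' : nat) (s s' : polygon n),
     conditions n m a b -> conditions n m a' b' ->
     represents (alt_sides a b) s ->
     represents (alt_sides a' b') s' ->
     (equivalent R s s' <-> (a = a' /\ b = b'))) /\
  (* exchanging a and b does not change the class *)
  (forall (a b : nat) (s s' : polygon n),
     represents (alt_sides a b) s ->
     represents (alt_sides b a) s' ->
     equivalent R s s').
Proof.
have m0 : (0 < m)%N by lia.
split=> [a b|]; last split.
- rewrite conditionsP; split=> [[s [sab ax]]|[[ao bo] [ah bh] g ab]].
    split; [exact (represents_odd hn hn3 sab)|exact (represents_bounds hn hn3 sab)|
            exact (represents_coprime hn hn3 sab)|].
    (* Equal sides would give n axes, and n = 2m differs from m. *)
    move=> ab; have : (axes R s #= `I_n).
      apply: (@card_axes R n m s id) => // c; split=> [[cn _]|[i lt ->]].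
        by exists c.
      by split=> //; apply: (represents_edge_symmetric hn hn3 sab); left.
    by rewrite card_eq_sym => /card_eq_trans /(_ ax) /card_eq_II; lia.
  have [s sab] := represents_exists hn hn3 ao bo ah bh g.
  exists s; split=> //; apply: (@card_axes R n m s (fun k => k.*2.+1)) => //.
    by move=> i j [] /double_inj.
  move=> c; split=> [[cn /(edge_symmetric_odd hn hn3 sab ab) co]|[i lt ->]].
    by exists c./2; lia.
  split; first by lia.
  by apply: (represents_edge_symmetric hn hn3 sab); right; rewrite /= odd_double.
- move=> a b a' b' s s' [_ _ [/andP[_ ab] _] _] [_ _ [/andP[_ ab'] _] _] sab sab'.
  (* The exchanged case a' = b, b' = a contradicts a < b and a' < b'. *)
  split=> [/(equivalent_alt_sides hn hn3 sab sab')|[ea eb]]; first lia.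
  by apply: (equivalent_shift R hn hn3 (k := 0) sab sab') => i; rewrite ea eb.
- move=> a b s s' sab sba; apply: (equivalent_shift R hn hn3 (k := 1) sab sba) => i.
  by rewrite /= (alt_sides_ordS hn).
Qed.
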